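(* Let $0\le\alpha\le1$ and let $(v_n)_{n\ge0}$ be a uniformly bounded $(\mathcal{F}_n)$-predictable sequence. Then the martingale transform $T$ given by $$(Tf)_n=\sum_{k=0}^n v_k\,d_kf,\qquad n\ge 0,$$ is bounded on $BMO^\alpha$; that is, there is a constant $C$ such that for every $f\in BMO^\alpha$ one has $Tf\in BMO^\alpha$ and $\|Tf\|_{BMO^\alpha}\le C\|f\|_{BMO^\alpha}$.
   Context: $(\Omega,\mathcal{F},P)$ is a complete probability space and $(\mathcal{F}_n)_{n\ge 0}$ is an increasing sequence of sub-$\sigma$-fields of $\mathcal{F}$ with $\mathcal{F}=\bigvee_n\mathcal{F}_n$. For a scalar-valued martingale $f=(f_n)_{n\ge0}$ write $d_nf=f_n-f_{n-1}$, with the convention $f_{-1}=0$. All martingales are assumed to be finite (there is $N$ with $d_nf=0$ for all $n>N$), and a martingale is identified with its final value, also denoted $f$ ($=f_\infty$). Predictable means that $v_n$ is scalar-valued and $\mathcal{F}_{n-1}$-measurable for $n\ge1$, and $v_0$ is $\mathcal{F}_0$-measurable; uniformly bounded means $\sup_n\|v_n\|_{L^\infty}<\infty$. For $0\le\alpha\le1$, an $L^2$-martingale $f$ belongs to $BMO^\alpha$ if $$\|f\|_{BMO^\alpha}:=\sup_{n\ge0}\ \sup_{A\in\mathcal{F}_n}P(A)^{-1/2-\alpha}\Big(\int_A|f-f_{n-1}|^2\,dP\Big)^{1/2}<\infty,$$ the inner supremum being over $A\in\mathcal{F}_n$ with $P(A)>0$. *)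

(* Defs.v *)
From HB Require Import structures.
From mathcomp Require Import all_boot all_order all_algebra.
From mathcomp Require Import all_classical all_reals all_analysis.
From mathcomp Require Import complex.

Set Implicit Arguments.
Unset Strict Implicit.
Unset Printing Implicit Defensive.

Import Order.TTheory GRing.Theory Num.Theory.
Import numFieldNormedType.Exports.

Local Open Scope classical_set_scope.
Local Open Scope ring_scope.

(* Scalars are the complex numbers R[i]; real-valued martingales and real
   multipliers are the special case of vanishing imaginary parts.  The library
   has neither a measurable structure on R[i] nor R[i]-valued integrals, so
   measurability, integrability and integrals are taken on real and imaginary
   parts; [normc] is the modulus with values in R. *)
Notation Re := (@complex.Re _).
Notation Im := (@complex.Im _).
Notation normc := (@Normc.normc _).

Section sub_sigma_fields.
Context d (Omega : measurableType d) (R : realType) (P : probability Omega R).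

(* Exact (not up to null sets) measurability of X for a sigma-field G. *)
Definition measurable_wrt (G : set (set Omega)) (X : Omega -> R[i]) : Prop :=
  forall B : set R, measurable B ->
    G ((Re \o X) @^-1` B) /\ G ((Im \o X) @^-1` B).

Definition cintegrable (X : Omega -> R[i]) : Prop :=
  P.-integrable [set: Omega] (EFin \o Re \o X) /\
  P.-integrable [set: Omega] (EFin \o Im \o X).

Definition is_cond_exp (G : set (set Omega)) (X Y : Omega -> R[i]) : Prop :=
  [/\ measurable_wrt G Y,
      cintegrable Y &
      forall A, G A ->
        \int[P]_(w in A) (Re (Y w))%:E = \int[P]_(w in A) (Re (X w))%:E /\
        \int[P]_(w in A) (Im (Y w))%:E = \int[P]_(w in A) (Im (X w))%:E]%E.

Definition generating_filtration (F : nat -> set (set Omega)) : Prop :=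
  [/\ forall n, sigma_algebra [set: Omega] (F n),
      forall n, F n `<=` measurable,
      forall n, F n `<=` F n.+1 &
      measurable = <<s \bigcup_n F n >>].

End sub_sigma_fields.

Section martingales.
Context d (Omega : measurableType d) (R : realType) (P : probability Omega R).
Variable F : nat -> set (set Omega).
Implicit Types (f v : nat -> Omega -> R[i]).

Definition martingale f : Prop :=
  [/\ forall n, measurable_wrt (F n) (f n),
      forall n, cintegrable P (f n) &
      forall n, is_cond_exp P (F n) (f n.+1) (f n)].

(* f_(n-1), with the convention f_(-1) = 0 *)
Definition prev f (n : nat) : Omega -> R[i] :=
  if n is m.+1 then f m else fun=> 0.

Definition mdiff f (n : nat) : Omega -> R[i] :=
  fun w => f n w - prev f n w.

Definition stops_at f (N : nat) : Prop :=
  forall n, (N < n)%N -> {ae P, forall w, mdiff f n w = 0}.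

Definition finite_martingale f : Prop :=
  martingale f /\ exists N, stops_at f N.

(* The final value of a finite martingale is f_N for any N with [stops_at f N];
   different choices of N agree almost everywhere.  The default 0%N given to
   [xget] is only reached when f is not finite. *)
Definition final f : Omega -> R[i] := f (xget 0%N [set N | stops_at f N]).

Definition L2_martingale f : Prop :=
  finite_martingale f /\ forall n, (normc \o f n) \in Lfun P 2%:E.

Definition bmo_norm (alpha : R) f : \bar R :=
  ereal_sup (range (fun n : nat =>
    ereal_sup [set (P A `^ (- (1 / 2) - alpha) *
                    (\int[P]_(w in A)
                       (normc (final f w - prev f n w) ^+ 2)%:E) `^ (1 / 2))%E
              | A in [set A | F n A /\ (0 < P A)%E]])).

Definition BMO (alpha : R) f : Prop :=
  L2_martingale f /\ (bmo_norm alpha f < +oo)%E.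

(* [n.-1] is n-1 for n >= 1 and 0 for n = 0. *)
Definition predictable v : Prop := forall n, measurable_wrt (F n.-1) (v n).

Definition uniformly_bounded v : Prop :=
  (ereal_sup (range (fun n => 'N[P]_+oo [EFin \o (normc \o v n)])) < +oo)%E.

Definition transform v f (n : nat) : Omega -> R[i] :=
  fun w => \sum_(k < n.+1) v k w * mdiff f k w.

End martingales.

(* Main.v *)
(** Let f be an L2 martingale and |v_k| <= K almost surely.  As v_k is
    F_(k-1)-measurable and bounded, v_k d_k f is again orthogonal to every square
    integrable F_(k-1)-measurable function, also after restriction to a set of
    F_(k-1).  Hence for A in F_n and m >= n the increments are orthogonal on A:
    the integral over A of |(Tf)_m - (Tf)_(n-1)|^2 is the sum over n <= k <= m
    of the integrals of |v_k d_k f|^2, which is at most K^2 times the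
    corresponding quantity for f.  Taking m large bounds every term of the
    BMO^alpha norm of Tf by K times that of f, whatever alpha is. *)
Require Import Defs.
From mathcomp Require Import all_boot all_order all_algebra.
From mathcomp Require Import all_classical all_reals all_analysis.
From mathcomp Require Import measurable_realfun ess_sup_inf complex ring.

Set Implicit Arguments.
Unset Strict Implicit.
Unset Printing Implicit Defensive.

Import Order.TTheory GRing.Theory Num.Theory.
Import numFieldNormedType.Exports.
Import HBSimple HBNNSimple.
(* Restores [prev], [Re] and [Im], which the libraries shadow. *)
Import Defs.

Local Open Scope classical_set_scope.
Local Open Scope ring_scope.

(** * Measurability with respect to a sub-sigma-field *)

Section sub_sigma_measurability.
Context d (Omega : measurableType d) (R : realType).
Variable G : set (set Omega).
Hypothesis sG : sigma_algebra [set: Omega] G.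
Implicit Types u : Omega -> R.

(** [G] is turned into a measurable type, so that the closure properties of [measurable_fun] and the
    approximation by simple functions apply to it directly. *)
Definition Gmeasurable u :=
  measurable_fun [set: g_sigma_algebraType G] (u : g_sigma_algebraType G -> R).

Lemma GmeasurableP u :
  Gmeasurable u <-> forall B, measurable B -> G (u @^-1` B).
Proof.
have E := measurable_g_measurableTypeE sG.
split=> [mu B mB|mu _ B mB]; last by rewrite setTI E; exact: mu.
by have := mu measurableT B mB; rewrite setTI E.
Qed.

Lemma Gmeasurable_measurable u : G `<=` measurable ->
  Gmeasurable u -> measurable_fun [set: Omega] u.
Proof.
by move=> Gm /GmeasurableP mu _ B mB; rewrite setTI; apply: Gm; exact: mu.
Qed.

Lemma measurable_wrtP (X : Omega -> R[i]) : measurable_wrt G X <->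
  Gmeasurable (Re \o X) /\ Gmeasurable (Im \o X).
Proof.
split=> [mX|[/GmeasurableP mr /GmeasurableP mi] B mB]; last by split; auto.
by split; apply/GmeasurableP => B /mX[].
Qed.

End sub_sigma_measurability.

(** * Orthogonality of centered real functions to functions measurable for [G] *)

Section orthogonality.
Context d (Omega : measurableType d) (R : realType) (P : probability Omega R).
Variable G : set (set Omega).
Hypothesis sG : sigma_algebra [set: Omega] G.
Hypothesis Gm : G `<=` measurable.
Local Open Scope ereal_scope.

Let mG : @measurable _ (g_sigma_algebraType G) = G :=
  measurable_g_measurableTypeE sG.

Let measurableG (B : set (g_sigma_algebraType G)) : measurable B -> G B.
Proof. by rewrite mG. Qed.

Let setIG A B : G A -> G B -> G (A `&` B).
Proof. by rewrite -mG; exact: measurableI. Qed.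

(** By linearity it is enough to treat indicators of level sets of [g]. These sets lie in [G], hence
    so do their intersections with [A], over which [Y] integrates to 0. *)
Lemma integral_sfun_mul_eq0 (g : {sfun g_sigma_algebraType G >-> R})
    (Y : Omega -> R) A : G A -> P.-integrable [set: Omega] (EFin \o Y) ->
  (forall B, G B -> \int[P]_(w in B) (Y w)%:E = 0) ->
  \int[P]_(w in A) (g w * Y w)%:E = 0.
Proof.
move=> GA iY Y0.
have Gp (y : R) : G (g @^-1` [set y]) by apply: measurableG; exact: measurable_sfunP.
have mp y : measurable (g @^-1` [set y] : set Omega) by exact: Gm.
have mA := Gm GA.
have iYA : P.-integrable A (EFin \o Y) by exact: integrableS iY.
have mY : measurable_fun A Y.
  by case/integrableP : (iYA) => /measurable_EFinP.
have iyY (y : R) : P.-integrable A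
    (fun w => (\1_(g @^-1` [set y]) w * Y w)%:E).
  apply: le_integrable (iYA) => //.
    by apply/measurable_EFinP; exact: measurable_funM.
  move=> w _ /=; rewrite lee_fin normrM indicE.
  by case: (_ \in _); rewrite ?normr1 ?mul1r// normr0 mul0r.
under eq_integral => w _.
  rewrite fimfunE fsbig_finite//= mulr_suml.
  under eq_bigr do rewrite -mulrA.
  rewrite -sumEFin.
  over.
rewrite integral_sum//; last first.
  by move=> y; under eq_fun do rewrite EFinM; exact: integrableZl.
rewrite big1// => y _.
under eq_integral do rewrite EFinM.
rewrite integralZl//.
have -> : \int[P]_(w in A) (\1_(g @^-1` [set y]) w * Y w)%:E =
    \int[P]_(w in A `&` g @^-1` [set y]) (Y w)%:E.
  rewrite integral_mkcondr; apply: eq_integral => w _.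
  by rewrite patchE indicE; case: ifP => _; rewrite ?mul1r ?mul0r.
by rewrite Y0 ?mule0//; exact: setIG.
Qed.

(** Passage from simple functions to nonnegative ones by dominated convergence. *)
Lemma integral_ge0_mul_eq0 (X Y : Omega -> R) A : G A ->
  (forall w, 0 <= X w)%R -> Gmeasurable G X ->
  P.-integrable [set: Omega] (EFin \o Y) ->
  P.-integrable [set: Omega] (EFin \o (X \* Y)%R) ->
  (forall B, G B -> \int[P]_(w in B) (Y w)%:E = 0) ->
  \int[P]_(w in A) (X w * Y w)%:E = 0.
Proof.
move=> GA X0 mX iY iXY Y0.
have mA := Gm GA.
(* The approximation is built on the measurable space carrying [G], so the simple functions [g n]
   are measurable for [G] and not merely for the ambient field. *)
have mXE : measurable_fun [set: g_sigma_algebraType G]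
  (EFin \o (X : g_sigma_algebraType G -> R)) by exact/measurable_EFinP.
pose g := nnsfun_approx measurableT mXE.
have gX w : EFin \o g^~ w @ \oo --> (X w)%:E.
  by apply: (@cvg_nnsfun_approx _ _ _ _ measurableT _ mXE) => // t _; rewrite lee_fin.
have gleX n w : (g n w <= X w)%R.
  rewrite -lee_fin /g nnsfun_approxE.
  by apply: le_approx => // t _; rewrite lee_fin.
have mY : measurable_fun [set: Omega] Y.
  by move/integrableP : iY => [/measurable_EFinP].
have mg n : measurable_fun [set: Omega] (g n : Omega -> R).
  apply: (Gmeasurable_measurable sG Gm); rewrite /Gmeasurable; exact: measurable_funP.
(* Since [0 <= g n <= X], the products [g n * Y] are dominated by [|X * Y|]. All their integrals
   vanish by the simple case, hence so does the limit. *)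
have := @dominated_cvg _ Omega R P A mA
  (fun n w => (g n w * Y w)%:E) (fun w => (X w * Y w)%:E)
  (fun w => `|(X w * Y w)%:E|).
move=> /(_ _ _ _ _ _)/cvg_lim <- //.
- under eq_fun do rewrite (integral_sfun_mul_eq0 (g _) GA iY Y0).
  exact: lim_cst.
- move=> n; apply: measurable_funTS; apply/measurable_EFinP.
  exact: measurable_funM.
- move=> w _; under eq_fun do rewrite EFinM; rewrite EFinM.
  apply: cvgeMr => //; exact: gX.
- apply: integrable_abse; exact: integrableS iXY.
- move=> n w _; rewrite lee_fin !normrM ler_wpM2r//.
  by rewrite !ger0_norm.
Qed.

End orthogonality.

(** * Algebra of the complex modulus *)

Section modulus.
Variable R : rcfType.
Implicit Types x y z : R[i].

Lemma Re_sub x y : Re (x - y) = Re x - Re y. Proof. by case: x; case: y. Qed.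
Lemma Im_sub x y : Im (x - y) = Im x - Im y. Proof. by case: x; case: y. Qed.
Lemma Re_add x y : Re (x + y) = Re x + Re y. Proof. by case: x; case: y. Qed.
Lemma Im_add x y : Im (x + y) = Im x + Im y. Proof. by case: x; case: y. Qed.
Lemma Re_mul x y : Re (x * y) = Re x * Re y - Im x * Im y.
Proof. by case: x; case: y. Qed.
Lemma Im_mul x y : Im (x * y) = Re x * Im y + Im x * Re y.
Proof. by case: x; case: y. Qed.
Lemma Re_conjc x : Re (conjc x) = Re x. Proof. by case: x. Qed.
Lemma Im_conjc x : Im (conjc x) = - Im x. Proof. by case: x. Qed.

Lemma normc_sqrt z : normc z = Num.sqrt (Re z ^+ 2 + Im z ^+ 2).
Proof. by case: z. Qed.

Lemma normc_ge0 z : 0 <= normc z.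
Proof. by rewrite normc_sqrt sqrtr_ge0. Qed.

Lemma sqr_normcE z : normc z ^+ 2 = Re z ^+ 2 + Im z ^+ 2.
Proof. by rewrite normc_sqrt sqr_sqrtr// addr_ge0// sqr_ge0. Qed.

Lemma normc_conjc x : normc (conjc x) = normc x.
Proof. by rewrite !normc_sqrt Re_conjc Im_conjc sqrrN. Qed.

Lemma le_Re_normc z : `|Re z| <= normc z.
Proof.
by rewrite normc_sqrt -sqrtr_sqr ler_wsqrtr// lerDl sqr_ge0.
Qed.

Lemma le_Im_normc z : `|Im z| <= normc z.
Proof.
by rewrite normc_sqrt -sqrtr_sqr ler_wsqrtr// lerDr sqr_ge0.
Qed.

(** The cross term is written with [conjc x] so that, after integration, it is a product of a
    function measurable for [G] and a centered one. *)
Lemma sqr_normcD x y :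
  normc (x + y) ^+ 2 = normc x ^+ 2 + normc y ^+ 2 + 2 * Re (conjc x * y).
Proof. by rewrite !sqr_normcE Re_mul Re_conjc Im_conjc Re_add Im_add; ring. Qed.

End modulus.

(** * Closure of complex measurability under the algebraic operations *)

Section measurable_wrt_closure.
Context d (Omega : measurableType d) (R : realType).
Variable G : set (set Omega).
Hypothesis sG : sigma_algebra [set: Omega] G.
Implicit Types X Y : Omega -> R[i].

Lemma measurable_wrtB X Y :
  measurable_wrt G X -> measurable_wrt G Y -> measurable_wrt G (X \- Y).
Proof.
move=> /(measurable_wrtP sG)[rX iX] /(measurable_wrtP sG)[rY iY].
apply/(measurable_wrtP sG); split.
- by rewrite (_ : _ \o _ = (Re \o X) \- (Re \o Y)); [exact: measurable_funB|
    apply/funext => w; exact: Re_sub].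
- by rewrite (_ : _ \o _ = (Im \o X) \- (Im \o Y)); [exact: measurable_funB|
    apply/funext => w; exact: Im_sub].
Qed.

Lemma measurable_wrtM X Y :
  measurable_wrt G X -> measurable_wrt G Y -> measurable_wrt G (X \* Y).
Proof.
move=> /(measurable_wrtP sG)[rX iX] /(measurable_wrtP sG)[rY iY].
apply/(measurable_wrtP sG); split.
- rewrite (_ : _ \o _ = (Re \o X) \* (Re \o Y) \- (Im \o X) \* (Im \o Y)).
    by apply: measurable_funB; exact: measurable_funM.
  by apply/funext => w; exact: Re_mul.
- rewrite (_ : _ \o _ = (Re \o X) \* (Im \o Y) \+ (Im \o X) \* (Re \o Y)).
    by apply: measurable_funD; exact: measurable_funM.
  by apply/funext => w; exact: Im_mul.
Qed.

Lemma measurable_wrt0 : measurable_wrt G (fun=> 0 : R[i]).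
Proof. by apply/(measurable_wrtP sG); split; exact: measurable_cst. Qed.

Lemma measurable_wrtN X : measurable_wrt G X -> measurable_wrt G (\- X).
Proof.
move=> mX; rewrite (_ : \- X = (fun=> 0) \- X); last first.
  by apply/funext => w; rewrite /= sub0r.
by apply: measurable_wrtB => //; exact: measurable_wrt0.
Qed.

Lemma measurable_wrtD X Y :
  measurable_wrt G X -> measurable_wrt G Y -> measurable_wrt G (X \+ Y).
Proof.
move=> mX mY; rewrite (_ : X \+ Y = X \- (\- Y)); last first.
  by apply/funext => w; rewrite /= opprK.
by apply: measurable_wrtB => //; exact: measurable_wrtN.
Qed.

Lemma measurable_wrtJ X : measurable_wrt G X -> measurable_wrt G (conjc \o X).
Proof.
move=> /(measurable_wrtP sG)[rX iX].
apply/(measurable_wrtP sG); split.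
- by rewrite (_ : _ \o _ = Re \o X)//; apply/funext => w; exact: Re_conjc.
- rewrite (_ : _ \o _ = \- (Im \o X)); first exact: measurableT_comp.
  by apply/funext => w; exact: Im_conjc.
Qed.

End measurable_wrt_closure.

(** * Square integrable complex functions *)

Section square_integrable.
Context d (Omega : measurableType d) (R : realType) (P : probability Omega R).
Implicit Types (u g : Omega -> R) (X Y v : Omega -> R[i]).

Lemma measurable_ReIm X : measurable_wrt measurable X ->
  measurable_fun [set: Omega] (Re \o X) /\
  measurable_fun [set: Omega] (Im \o X).
Proof.
have sm : sigma_algebra [set: Omega] measurable by exact: sigma_algebra_measurable.
by move=> /(measurable_wrtP sm)[rX iX]; split;
  exact: (Gmeasurable_measurable sm).
Qed.

Lemma measurable_normc X : measurable_wrt measurable X ->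
  measurable_fun [set: Omega] (normc \o X).
Proof.
move=> /measurable_ReIm[rX iX].
rewrite (_ : _ \o _ = Num.sqrt \o (fun w => Re (X w) ^+ 2 + Im (X w) ^+ 2)).
  apply: measurableT_comp.
    by apply: continuous_measurable_fun; exact: sqrt_continuous.
  by apply: measurable_funD; apply: measurable_funX.
by apply/funext => w; exact: normc_sqrt.
Qed.

Lemma Lfun2P u : u \in Lfun P 2%:E <->
  measurable_fun [set: Omega] u /\
  P.-integrable [set: Omega] (EFin \o (fun w => u w ^+ 2)).
Proof.
split=> [Lu|[mu iu]].
  by split; [have /set_mem := sub_Lfun_mfun Lu|exact: Lfun2_integrable_sqr].
rewrite inE; apply/andP; split; rewrite inE//=.
rewrite /finite_norm unlock poweR_lty//.
case/integrableP : iu => _; apply: le_lt_trans; rewrite le_eqVlt.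
apply/orP; left; apply/eqP; apply: eq_integral => w _ /=.
by rewrite powR_mulrn// normrX.
Qed.

(** The sign of [K] is free: [K * |g|] is at most [|K * g|], and the squares are then compared. *)
Lemma Lfun2_ae_dominated u g K : measurable_fun [set: Omega] u ->
  g \in Lfun P 2%:E -> {ae P, forall w, `|u w| <= K * `|g w|} ->
  u \in Lfun P 2%:E.
Proof.
move=> mu /Lfun2P[mg ig] ug; apply/Lfun2P; split => //.
have iK := integrableZl measurableT (K ^+ 2) ig.
have mu2 : measurable_fun [set: Omega] (fun w => u w ^+ 2).
  exact: measurable_funX.
apply/integrableP; split; first exact/measurable_EFinP.
case/integrableP : iK => mK; apply: le_lt_trans.
apply: ae_ge0_le_integral => //.
- by apply: measurableT_comp => //; exact/measurable_EFinP.
- exact: measurableT_comp.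
- apply: filterS ug => w ugw _ /=.
  rewrite lee_fin -exprMn !normrX lerXn2r ?nnegrE// normrM.
  by rewrite (le_trans ugw)// ler_wpM2r// ler_norm.
Qed.

(** Integrals are taken on real and imaginary parts, so square integrability is too; [L2cP] links it
    to the modulus, used in [L2_martingale]. *)
Definition L2c X := Re \o X \in Lfun P 2%:E /\ Im \o X \in Lfun P 2%:E.

Lemma L2cP X : measurable_wrt measurable X ->
  L2c X <-> normc \o X \in Lfun P 2%:E.
Proof.
move=> mX; have [rX iX] := measurable_ReIm mX; have nX := measurable_normc mX.
split=> [[/Lfun2P[_ i1] /Lfun2P[_ i2]]|LX].
  apply/Lfun2P; split => //.
  apply: eq_integrable (integrableD measurableT i1 i2) => // w _ /=.
  by rewrite sqr_normcE.
split; apply: (Lfun2_ae_dominated (K := 1) _ LX) => //; apply: aeW => w /=;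
  rewrite mul1r [leRHS]ger0_norm ?normc_ge0//.
- exact: le_Re_normc.
- exact: le_Im_normc.
Qed.

Lemma L2cB X Y : L2c X -> L2c Y -> L2c (X \- Y).
Proof.
move=> [rX iX] [rY iY]; split.
- rewrite (_ : _ \o _ = (Re \o X) - (Re \o Y)).
    by rewrite rpredB ?lee1n.
  by apply/funext => w; exact: Re_sub.
- rewrite (_ : _ \o _ = (Im \o X) - (Im \o Y)).
    by rewrite rpredB ?lee1n.
  by apply/funext => w; exact: Im_sub.
Qed.

Lemma L2c_integrable X : L2c X -> cintegrable P X.
Proof.
have Pfin : P [set: Omega] \is a fin_num by exact: fin_num_measure.
by move=> [rX iX]; split; apply/Lfun1_integrable; exact: Lfun_subset12.
Qed.

Lemma L2c_bounded_mul v X (K : R) : measurable_wrt measurable v ->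
  measurable_wrt measurable X -> {ae P, forall w, normc (v w) <= K} ->
  L2c X -> L2c (v \* X).
Proof.
move=> mv mX vK LX; have sm := @sigma_algebra_measurable _ Omega.
have mvX := measurable_wrtM sm mv mX.
apply/(L2cP mvX); move/(L2cP mX): LX => LX.
apply: (Lfun2_ae_dominated (K := K) _ LX); first exact: measurable_normc.
apply: filterS vK => w vKw /=.
by rewrite Normc.normcM !ger0_norm ?mulr_ge0 ?normc_ge0// ler_wpM2r// normc_ge0.
Qed.

End square_integrable.

(** * Centered functions and the Pythagorean identity *)

Section centered.
Context d (Omega : measurableType d) (R : realType) (P : probability Omega R).
Variable G : set (set Omega).
Hypothesis sG : sigma_algebra [set: Omega] G.
Hypothesis Gm : G `<=` measurable.

(** The positive and negative parts of [X] are measurable for [G], and their products with [Y] are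
    integrable because [|X * Y|] dominates them. *)
Lemma integral_mul_eq0 (X Y : Omega -> R) A : G A -> Gmeasurable G X ->
  P.-integrable [set: Omega] (EFin \o Y) ->
  P.-integrable [set: Omega] (EFin \o (X \* Y)) ->
  (forall B, G B -> \int[P]_(w in B) (Y w)%:E = 0)%E ->
  (\int[P]_(w in A) (X w * Y w)%:E = 0)%E.
Proof.
move=> GA mX iY iXY Y0; have mA := Gm GA.
have mXp : Gmeasurable G (X^\+) by exact: measurable_funrpos.
have mXn : Gmeasurable G (X^\-) by exact: measurable_funrneg.
have mY : measurable_fun [set: Omega] Y.
  by case/integrableP : (iY) => /measurable_EFinP.
have normX w : `|X w| = X^\+ w + X^\- w.
  by have /(congr1 (fun h => h w)) := funrposDneg X.
have iXpY : P.-integrable [set: Omega] (EFin \o (X^\+ \* Y)).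
  apply: le_integrable (iXY) => //.
    apply/measurable_EFinP; apply: measurable_funM => //.
    exact: Gmeasurable_measurable mXp.
  move=> w _ /=; rewrite lee_fin !normrM ler_wpM2r// normX.
  by rewrite ger0_norm// lerDl.
have iXnY : P.-integrable [set: Omega] (EFin \o (X^\- \* Y)).
  apply: le_integrable (iXY) => //.
    apply/measurable_EFinP; apply: measurable_funM => //.
    exact: Gmeasurable_measurable mXn.
  move=> w _ /=; rewrite lee_fin !normrM ler_wpM2r// normX.
  by rewrite ger0_norm// lerDr.
have XE w : X w = X^\+ w - X^\- w.
  by rewrite -[in LHS](funrposBneg X).
under eq_integral do rewrite XE mulrBl EFinB.
rewrite integralB//; [|exact: integrableS iXpY|exact: integrableS iXnY].
by rewrite !(integral_ge0_mul_eq0 sG Gm GA)// sube0.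
Qed.

(* Zero conditional expectation given [G]. *)
Definition centered (Z : Omega -> R[i]) := forall A, G A ->
  (\int[P]_(w in A) (Re (Z w))%:E = 0 /\ \int[P]_(w in A) (Im (Z w))%:E = 0)%E.

(** Both parts of the product are combinations of four real products, each integrable by
    Cauchy-Schwarz and each of integral 0, since both parts of [Z] are centered. *)
Lemma centeredM (X Z : Omega -> R[i]) : measurable_wrt G X ->
  L2c P X -> L2c P Z -> centered Z -> centered (X \* Z).
Proof.
move=> /(measurable_wrtP sG)[mrX miX] [rX iX] LZ cZ A GA; have mA := Gm GA.
have [irZ iiZ] := L2c_integrable LZ; move: LZ => [rZ iZ].
have iM (u g : Omega -> R) : u \in Lfun P 2%:E -> g \in Lfun P 2%:E ->
    P.-integrable [set: Omega] (EFin \o (u \* g)).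
  by move=> Lu Lg; apply/Lfun1_integrable; exact: Lfun2_mul_Lfun1.
have iMA (u g : Omega -> R) : u \in Lfun P 2%:E -> g \in Lfun P 2%:E ->
    P.-integrable A (EFin \o (u \* g)).
  by move=> Lu Lg; apply: integrableS (iM _ _ Lu Lg).
have Zr B : G B -> (\int[P]_(w in B) ((Re \o Z) w)%:E = 0)%E by move=> /cZ[].
have Zi B : G B -> (\int[P]_(w in B) ((Im \o Z) w)%:E = 0)%E by move=> /cZ[].
have rr := integral_mul_eq0 GA mrX irZ (iM _ _ rX rZ) Zr.
have ii := integral_mul_eq0 GA miX iiZ (iM _ _ iX iZ) Zi.
have ri := integral_mul_eq0 GA mrX iiZ (iM _ _ rX iZ) Zi.
have ir := integral_mul_eq0 GA miX irZ (iM _ _ iX rZ) Zr.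
split.
- under eq_integral do rewrite Re_mul EFinB.
  rewrite integralB//; [|exact: iMA rX rZ|exact: iMA iX iZ].
  by move: rr ii => /= -> ->; rewrite sube0.
- under eq_integral do rewrite Im_mul EFinD.
  rewrite integralD//; [|exact: iMA rX iZ|exact: iMA iX rZ].
  by move: ri ir => /= -> ->; rewrite adde0.
Qed.

(** With its converse below, this turns the martingale property into centeredness of increments.
    Integrability makes the integrals finite, so that they can be subtracted in the extended
    reals. *)
Lemma is_cond_exp_centered (X Y : Omega -> R[i]) : cintegrable P X ->
  is_cond_exp P G X Y -> centered (X \- Y).
Proof.
move=> [irX iiX] [_ [irY iiY] XY] A GA; have mA := Gm GA.
have iA (h : Omega -> R) : P.-integrable [set: Omega] (EFin \o h) ->
  P.-integrable A (EFin \o h) by move=> ih; exact: integrableS ih.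
have [XYr XYi] := XY _ GA.
split.
- under eq_integral do rewrite Re_sub EFinB.
  rewrite integralB//; [|exact: iA irX|exact: iA irY].
  by rewrite XYr subee//; exact: (integrable_fin_num mA (iA (Re \o X) irX)).
- under eq_integral do rewrite Im_sub EFinB.
  rewrite integralB//; [|exact: iA iiX|exact: iA iiY].
  by rewrite XYi subee//; exact: (integrable_fin_num mA (iA (Im \o X) iiX)).
Qed.

Lemma centered_is_cond_exp (X Y : Omega -> R[i]) : measurable_wrt G Y ->
  cintegrable P X -> cintegrable P Y -> centered (X \- Y) ->
  is_cond_exp P G X Y.
Proof.
move=> mY [irX iiX] [irY iiY] XY; split => // A GA; have mA := Gm GA.
have iA (h : Omega -> R) : P.-integrable [set: Omega] (EFin \o h) ->
  P.-integrable A (EFin \o h) by move=> ih; exact: integrableS ih.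
have [XYr XYi] := XY _ GA; split.
- move: XYr; under eq_integral do rewrite Re_sub EFinB.
  rewrite integralB//; [|exact: iA irX|exact: iA irY].
  have fX := integrable_fin_num mA (iA (Re \o X) irX).
  move/eqP; rewrite sube_eq//.
  by rewrite add0e => /eqP ->.
- move: XYi; under eq_integral do rewrite Im_sub EFinB.
  rewrite integralB//; [|exact: iA iiX|exact: iA iiY].
  have fX := integrable_fin_num mA (iA (Im \o X) iiX).
  move/eqP; rewrite sube_eq//.
  by rewrite add0e => /eqP ->.
Qed.

Lemma L2c_sqr_integrable (X : Omega -> R[i]) : measurable_wrt measurable X ->
  L2c P X -> P.-integrable [set: Omega] (fun w => (normc (X w) ^+ 2)%:E).
Proof. by move=> mX /(L2cP _ mX)/Lfun2P[]. Qed.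

(** Expanding the square leaves the cross term [2 * Re (conjc S * Z)], which integrates to 0 over
    [A] by [centeredM], as [conjc S] is measurable for [G]. *)
Lemma pythagoras (S Z : Omega -> R[i]) A : G A ->
  measurable_wrt G S -> measurable_wrt measurable Z ->
  L2c P S -> L2c P Z -> centered Z ->
  (\int[P]_(w in A) (normc (S w + Z w) ^+ 2)%:E =
   \int[P]_(w in A) (normc (S w) ^+ 2)%:E +
   \int[P]_(w in A) (normc (Z w) ^+ 2)%:E)%E.
Proof.
move=> GA mS mZ LS LZ cZ; have mA := Gm GA.
have mS' : measurable_wrt measurable S.
  by move=> B mB; have [? ?] := mS B mB; split; exact: Gm.
have iS : P.-integrable A (fun w => (normc (S w) ^+ 2)%:E).
  exact: integrableS (L2c_sqr_integrable mS' LS).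
have iZ : P.-integrable A (fun w => (normc (Z w) ^+ 2)%:E).
  exact: integrableS (L2c_sqr_integrable mZ LZ).
have LSJ : L2c P (conjc \o S).
  have sm := @sigma_algebra_measurable _ Omega.
  apply/(L2cP _ (measurable_wrtJ sm mS')).
  rewrite (_ : _ \o _ = normc \o S); first exact/(L2cP _ mS').
  by apply/funext => w /=; rewrite normc_conjc.
have [cSZ _] := centeredM (measurable_wrtJ sG mS) LSJ LZ cZ GA.
have iSZ : P.-integrable A (fun w => (Re (conjc (S w) * Z w))%:E).
  move: LSJ LZ => [rS iS'] [rZ iZ'].
  have iM (u g : Omega -> R) : u \in Lfun P 2%:E -> g \in Lfun P 2%:E ->
      P.-integrable A (EFin \o (u \* g)).
    move=> Lu Lg.
    suff : P.-integrable [set: Omega] (EFin \o (u \* g)) by exact: integrableS.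
    by apply/Lfun1_integrable; exact: Lfun2_mul_Lfun1.
  apply: eq_integrable (integrableB mA (iM _ _ rS rZ) (iM _ _ iS' iZ')) => //.
  by move=> w _; rewrite Re_mul EFinB.
under eq_integral do rewrite sqr_normcD EFinD EFinD (EFinM 2).
rewrite integralD//; [|exact: integrableD|exact: (integrableZl mA 2 iSZ)].
rewrite integralD// integralZl//.
by move: cSZ => /= ->; rewrite mule0 adde0.
Qed.

End centered.

(** * Square integrable martingales and their increments *)

Section L2_martingales.
Context d (Omega : measurableType d) (R : realType) (P : probability Omega R).
Variable F : nat -> set (set Omega).
Hypothesis FP : generating_filtration F.
Implicit Types f v : nat -> Omega -> R[i].

Let sF n : sigma_algebra [set: Omega] (F n). Proof. by case: FP. Qed.
Let Fm n : F n `<=` measurable.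
Proof. by case: FP => _ + _ _; exact. Qed.
Let sm : sigma_algebra [set: Omega] measurable.
Proof. exact: sigma_algebra_measurable. Qed.

Lemma filtration_le n m : (n <= m)%N -> F n `<=` F m.
Proof.
have [_ _ FS _] := FP; elim: m => [|m ih]; first by rewrite leqn0 => /eqP ->.
by rewrite leq_eqVlt => /predU1P[->//|/ih nm]; exact: subset_trans nm (FS m).
Qed.

Lemma measurable_wrt_le n m (X : Omega -> R[i]) : (n <= m)%N ->
  measurable_wrt (F n) X -> measurable_wrt (F m) X.
Proof.
by move=> /filtration_le nm mX B /mX[rX iX]; split; exact: nm.
Qed.

Lemma measurable_wrt_measurable n (X : Omega -> R[i]) :
  measurable_wrt (F n) X -> measurable_wrt measurable X.
Proof. by move=> mX B /mX[rX iX]; split; apply: (Fm (n := n)). Qed.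

Section increments.
Variable f : nat -> Omega -> R[i].
Hypotheses (mf : martingale P F f) (L2f : forall n, L2c P (f n)).

Lemma measurable_martingale n : measurable_wrt (F n) (f n).
Proof. by case: mf. Qed.

Lemma measurable_prev n m : (n <= m)%N -> measurable_wrt (F m) (prev f n).
Proof.
case: n => [_|n nm] /=; first exact: measurable_wrt0.
by apply: (measurable_wrt_le (ltnW nm)); exact: measurable_martingale.
Qed.

Lemma L2c_prev n : L2c P (prev f n).
Proof.
case: n => [|n] //=; split; apply/Lfun2P; split; try exact: measurable_cst;
  by under eq_fun do rewrite expr0n; exact: integrable0.
Qed.

Lemma measurable_mdiff n : measurable_wrt (F n) (mdiff f n).
Proof.
by apply: measurable_wrtB => //; [exact: measurable_martingale|
  exact: measurable_prev].
Qed.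

Lemma L2c_mdiff n : L2c P (mdiff f n).
Proof. by apply: L2cB => //; exact: L2c_prev. Qed.

(** The index starts at 1: [mdiff f 0] is [f 0], whose mean is arbitrary. *)
Lemma centered_mdiff n : centered P (F n) (mdiff f n.+1).
Proof.
by case: mf => _ intf cf; exact: (is_cond_exp_centered (@Fm n) (intf _) (cf n)).
Qed.

(** The Pythagorean identity for [F m]: [f m - prev f n] is measurable for [F m], the next increment
    is centered given [F m], and [A] belongs to [F m] because [n <= m]. *)
Lemma increment_pythagoras n m A : (n <= m)%N -> F n A ->
  (\int[P]_(w in A) (normc (f m.+1 w - prev f n w) ^+ 2)%:E =
   \int[P]_(w in A) (normc (f m w - prev f n w) ^+ 2)%:E +
   \int[P]_(w in A) (normc (mdiff f m.+1 w) ^+ 2)%:E)%E.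
Proof.
move=> nm FA.
rewrite -(@pythagoras _ _ _ P (F m) (sF m) (@Fm m) (f m \- prev f n)
  (mdiff f m.+1)).
- by apply: eq_integral => w _; rewrite /mdiff /= [in RHS]addrC subrKA.
- exact: filtration_le FA.
- apply: measurable_wrtB => //; first exact: measurable_martingale.
  exact: measurable_prev.
- by apply: measurable_wrt_measurable; exact: measurable_mdiff.
- by apply: L2cB => //; exact: L2c_prev.
- exact: L2c_mdiff.
- exact: centered_mdiff.
Qed.

End increments.

(** * The martingale transform and its increments *)

Section transform.
Variables (f v : nat -> Omega -> R[i]) (K : R).
Hypotheses (mf : martingale P F f) (L2f : forall n, L2c P (f n)).
Hypotheses (pv : predictable F v).
Hypothesis vK : forall n, {ae P, forall w, normc (v n w) <= K}.

Let T := transform v f.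

Lemma transformS n w : T n.+1 w = T n w + v n.+1 w * mdiff f n.+1 w.
Proof. by rewrite /T /transform big_ord_recr. Qed.

Lemma mdiff_transform n : mdiff T n = v n \* mdiff f n.
Proof.
apply/funext => w; case: n => [|n]; rewrite /mdiff /=.
  by rewrite /T /transform big_ord1 /mdiff /= !subr0.
by rewrite transformS addrAC subrr add0r.
Qed.

Lemma measurable_wrt_multiplier n : measurable_wrt measurable (v n).
Proof. exact: measurable_wrt_measurable (pv n). Qed.

(** On a probability space the constant [K] is square integrable and dominates [v n]; [centeredM]
    asks for this. *)
Lemma L2c_multiplier n : L2c P (v n).
Proof.
have mv := measurable_wrt_multiplier n; apply/(L2cP _ mv).
apply: (Lfun2_ae_dominated (g := cst 1) (K := K)).
- exact: measurable_normc.
- exact: Lfun_cst.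
- apply: filterS (vK n) => w vw /=.
  by rewrite normr1 mulr1 ger0_norm// normc_ge0.
Qed.

Lemma measurable_transform n : measurable_wrt (F n) (T n).
Proof.
elim: n => [|n ih].
  rewrite (_ : T 0%N = v 0%N \* mdiff f 0%N).
    by apply: measurable_wrtM => //; [exact: (pv 0%N)|exact: measurable_mdiff].
  by apply/funext => w; rewrite /T /transform big_ord1.
rewrite (_ : T n.+1 = T n \+ (v n.+1 \* mdiff f n.+1)).
  apply: measurable_wrtD => //; first exact: measurable_wrt_le ih.
  apply: measurable_wrtM => //; last exact: measurable_mdiff.
  exact: measurable_wrt_le (pv n.+1).
by apply/funext => w; exact: transformS.
Qed.

Lemma L2c_mdiff_transform n : L2c P (mdiff T n).
Proof.
rewrite mdiff_transform; apply: (L2c_bounded_mul (K := K)) => //.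
- exact: measurable_wrt_multiplier.
- by apply: measurable_wrt_measurable; exact: measurable_mdiff.
- exact: L2c_mdiff.
Qed.

Lemma L2c_transform n : L2c P (T n).
Proof.
elim: n => [|n ih].
  have := L2c_mdiff_transform 0%N.
  by rewrite (_ : mdiff T 0%N = T 0%N)//; apply/funext => w; rewrite /mdiff /= subr0.
(* The sum, and then the opposite of [T n], are written as differences so that [L2cB] suffices. *)
rewrite (_ : T n.+1 = mdiff T n.+1 \- (\- T n)); last first.
  by apply/funext => w; rewrite /mdiff /= opprK subrK.
apply: L2cB; first exact: L2c_mdiff_transform.
rewrite (_ : \- T n = (T n \- T n) \- T n); last first.
  by apply/funext => w; rewrite /= subrr sub0r.
by apply: L2cB => //; exact: L2cB.
Qed.

Lemma martingale_transform : martingale P F T.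
Proof.
split=> [n|n|n]; first exact: measurable_transform.
  by apply: L2c_integrable; exact: L2c_transform.
apply: (centered_is_cond_exp (@Fm n)).
- exact: measurable_transform.
- by apply: L2c_integrable; exact: L2c_transform.
- by apply: L2c_integrable; exact: L2c_transform.
rewrite (_ : _ \- _ = mdiff T n.+1)// mdiff_transform.
apply: (centeredM (sF n) (@Fm n)) => //.
(* Predictability at index [n.+1] is measurability for [F n], since [n.+1.-1] computes to [n]. *)
- exact: (pv n.+1).
- exact: L2c_multiplier.
- exact: L2c_mdiff.
- exact: centered_mdiff.
Qed.

Lemma le_integral_mdiff_transform n A : measurable A ->
  (\int[P]_(w in A) (normc (mdiff T n w) ^+ 2)%:E <=
   (K ^+ 2)%:E * \int[P]_(w in A) (normc (mdiff f n w) ^+ 2)%:E)%E.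
Proof.
move=> mA.
have mn (X : Omega -> R[i]) : measurable_wrt measurable X ->
    measurable_fun A (fun w => (normc (X w) ^+ 2)%:E).
  move=> mX; apply: measurable_funTS; apply/measurable_EFinP.
  by apply: measurable_funX; exact: measurable_normc.
have mdf : measurable_wrt measurable (mdiff f n).
  by apply: measurable_wrt_measurable; exact: measurable_mdiff.
have mvf := measurable_wrtM sm (measurable_wrt_multiplier n) mdf.
rewrite mdiff_transform -ge0_integralZl//; last 3 first.
- exact: mn.
- by move=> w _; rewrite lee_fin sqr_ge0.
- by rewrite lee_fin sqr_ge0.
apply: ae_ge0_le_integral => //.
- by move=> w _; rewrite lee_fin sqr_ge0.
- exact: mn.
- by move=> w _; rewrite mule_ge0// lee_fin sqr_ge0.
- by apply: emeasurable_funM => //; exact: mn.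
(* Squaring the bound needs [0 <= K], which follows at such a point from
   [0 <= normc (v n w) <= K]. *)
- apply: filterS (vK n) => w vw _ /=.
  rewrite -EFinM lee_fin Normc.normcM exprMn ler_wpM2r ?sqr_ge0//.
  by rewrite lerXn2r ?nnegrE ?normc_ge0// (le_trans _ vw)// normc_ge0.
Qed.

(** Induction on [m] from [n]: the transform is itself a square integrable martingale, so
    [increment_pythagoras] splits off the last increment on both sides. *)
Lemma le_integral_transform n m A : (n <= m)%N -> F n A ->
  (\int[P]_(w in A) (normc (T m w - prev T n w) ^+ 2)%:E <=
   (K ^+ 2)%:E * \int[P]_(w in A) (normc (f m w - prev f n w) ^+ 2)%:E)%E.
Proof.
move=> nm FA; have mA := Fm FA.
(* The start [m = n] arises both here, with [n = 0], and on the next line; there the difference is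
   the single increment of index [n]. *)
elim: m nm => [|m ih]; first by rewrite leqn0 => /eqP ->; exact: le_integral_mdiff_transform.
rewrite leq_eqVlt ltnS => /predU1P[->|nm]; first exact: le_integral_mdiff_transform.
rewrite (increment_pythagoras martingale_transform L2c_transform nm FA).
rewrite (increment_pythagoras mf L2f nm FA).
rewrite muleDr//; first by apply: leeD; [exact: ih|exact: le_integral_mdiff_transform].
by apply: ge0_adde_def; rewrite inE; apply: integral_ge0 => w _;
  rewrite lee_fin sqr_ge0.
Qed.

End transform.

(** * The final value of a finite martingale, up to null sets *)

Lemma stops_at_ae f N m : stops_at P f N -> (N <= m)%N ->
  {ae P, forall w, f N w = f m w}.
Proof.
move=> fN; elim: m => [|m ih]; first by rewrite leqn0 => /eqP ->; exact: aeW.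
rewrite leq_eqVlt => /predU1P[->|Nm]; first exact: aeW.
apply: filterS2 (ih Nm) (fN m.+1 Nm) => w -> /eqP.
by rewrite /mdiff subr_eq0 => /eqP ->.
Qed.

Lemma final_ae f : finite_martingale P F f -> exists N, forall m, (N <= m)%N ->
  {ae P, forall w, final P f w = f m w}.
Proof.
(* The witness is the index chosen in [final]. Finiteness of [f] makes the set nonempty, so the
   default 0 is not what justifies the choice. *)
move=> [_ ex]; exists (xget 0%N [set N | stops_at P f N]) => m.
by apply: stops_at_ae; exact: (xgetPex 0%N ex).
Qed.

Lemma integral_final f m n A : finite_martingale P F f -> measurable A ->
  {ae P, forall w, final P f w = f m w} ->
  (\int[P]_(w in A) (normc (final P f w - prev f n w) ^+ 2)%:E =
   \int[P]_(w in A) (normc (f m w - prev f n w) ^+ 2)%:E)%E.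
Proof.
move=> [mf _] mA fm.
(* Stated for every [k], because [final P f] is itself some [f k]. *)
have mn k : measurable_fun A (fun w => (normc (f k w - prev f n w) ^+ 2)%:E).
  apply: measurable_funTS; apply/measurable_EFinP; apply: measurable_funX.
  apply: (@measurable_normc _ _ _ (f k \- prev f n)); apply: measurable_wrtB => //.
    exact: measurable_wrt_measurable (measurable_martingale mf k).
  exact: measurable_wrt_measurable (measurable_prev mf (leqnn n)).
apply: ae_eq_integral => //; first exact: mn.
by apply: filterS fm => w + _ => ->.
Qed.

End L2_martingales.

(** The constant is the supremum of the essential suprema, finite by assumption, so one [K] serves
    all [n]. *)
Lemma uniformly_bounded_ae d (Omega : measurableType d) (R : realType)
    (P : probability Omega R) (v : nat -> Omega -> R[i]) :
  uniformly_bounded P v ->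
  exists2 K : R, 0 <= K & forall n, {ae P, forall w, normc (v n w) <= K}.
Proof.
rewrite /uniformly_bounded; set s := ereal_sup _ => s_lty.
have vs n : ('N[P]_+oo [EFin \o (normc \o v n)] <= s)%E.
  by apply: ereal_sup_ubound; exists n.
have s0 : (0 <= s)%E by rewrite (le_trans _ (vs 0%N))// Lnorm_ge0.
have sfin : s \is a fin_num by rewrite ge0_fin_numE.
exists (fine s); first exact: fine_ge0.
(* The norm of exponent [+oo] is the essential supremum only on a space of positive measure. *)
move=> n; have PT : (0 < P [set: Omega])%E by rewrite probability_setT lte01.
have := vs n; rewrite unlock; case: ifPn => [_|/negP[]//].
move=> /ess_supP; apply: filterS => w /=.
by rewrite -[s]fineK// lee_fin; apply: le_trans; exact: ler_norm.
Qed.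

Theorem theorem3p2 (R : realType) (d : measure_display)
    (Omega : measurableType d) (P : probability Omega R)
    (F : nat -> set (set Omega)) (alpha : R) (v : nat -> Omega -> R[i])
    (P_complete : measure_is_complete P)
    (F_filtration : generating_filtration F)
    (alpha_ge0 : 0 <= alpha) (alpha_le1 : alpha <= 1)
    (v_predictable : predictable F v)
    (v_bounded : uniformly_bounded P v) :
  exists C : R, forall f : nat -> Omega -> R[i],
    BMO P F alpha f ->
    BMO P F alpha (transform v f) /\
    (bmo_norm P F alpha (transform v f) <= C%:E * bmo_norm P F alpha f)%E.
Proof.
have [K K0 vK] := uniformly_bounded_ae v_bounded.
exists K => f [[[mf [N fN]] L2nf] bf].
have L2f n : L2c P (f n).
  apply/(L2cP _ (measurable_wrt_measurable F_filtration _)); last exact: L2nf.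
  exact: (measurable_martingale mf n).
have mT := martingale_transform F_filtration mf L2f v_predictable vK.
have fin_f : finite_martingale P F f by split => //; exists N.
have fin_T : finite_martingale P F (transform v f).
  (* The transform stops no later than [f], as its increments are [v n * mdiff f n]. *)
  split => //; exists N => n Nn; apply: filterS (fN n Nn) => w fw.
  by rewrite mdiff_transform /= fw mulr0.
have L2T : L2_martingale P F (transform v f).
  split => // n.
  apply/(L2cP _ (measurable_wrt_measurable F_filtration (measurable_martingale mT n))).
  exact: (L2c_transform F_filtration mf L2f v_predictable vK).
suff le_norm : (bmo_norm P F alpha (transform v f) <= K%:E * bmo_norm P F alpha f)%E.
  split; last exact: le_norm.
  split; first exact: L2T.
  apply: le_lt_trans le_norm _.
  by apply: lte_mul_pinfty; rewrite ?lee_fin.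
apply: ge_ereal_sup => _ [n _ <-]; apply: ge_ereal_sup => _ [A [FA PA] <-].
(* The weight is a common nonnegative factor on both sides, so its dependence on [alpha] can stay
   hidden. *)
set c := (P A `^ _)%E.
have mA : measurable A by have [_ Fm _ _] := F_filtration; exact: Fm FA.
have [Nf f_fin] := final_ae fin_f.
have [NT T_fin] := final_ae fin_T.
(* Large enough that [f m] and the transform at [m] both equal their final values almost everywhere,
   and that [n <= m]. *)
pose m := maxn n (maxn Nf NT).
have nm : (n <= m)%N by rewrite leq_maxl.
rewrite (@integral_final _ _ _ P F F_filtration _ m)//; last first.
  by apply: T_fin; rewrite !leq_max leqnn !orbT.
have sqr0 (g : nat -> Omega -> R[i]) :
    (0 <= \int[P]_(w in A) (normc (g m w - prev g n w) ^+ 2)%:E)%E.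
  by apply: integral_ge0 => w _; rewrite lee_fin sqr_ge0.
have bmo_ge : (c * (\int[P]_(w in A) (normc (f m w - prev f n w) ^+ 2)%:E) `^ (1 / 2)
    <= bmo_norm P F alpha f)%E.
  rewrite -(integral_final F_filtration n fin_f mA) //; last first.
    by apply: f_fin; rewrite !leq_max leqnn !orbT.
  apply: le_trans (ereal_sup_ubound _); last by exists n.
  by apply: ereal_sup_ubound; exists A.
apply: (@le_trans _ _ (K%:E *
  (c * (\int[P]_(w in A) (normc (f m w - prev f n w) ^+ 2)%:E) `^ (1 / 2)))%E).
  rewrite muleCA lee_wpmul2l ?poweR_ge0//.
  (* As [0 <= K], the constant is the square root of the [K ^+ 2] in the integral estimate and can
     be moved under the exponent. *)
  have -> : K%:E = ((K ^+ 2)%:E `^ (1 / 2))%E.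
    by rewrite poweR_EFin -powR_mulrn// -powRrM mul1r mulfV// powRr1.
  rewrite -poweRM ?lee_fin ?sqr_ge0//.
  apply: gt0_ler_poweR.
  - by rewrite divr_ge0.
  - by rewrite in_itv /= leey sqr0.
  - by rewrite in_itv /= leey andbT mule_ge0// lee_fin sqr_ge0.
  - exact: (le_integral_transform F_filtration mf L2f v_predictable vK nm FA).
by rewrite lee_wpmul2l// lee_fin.
Qed.
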